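(* Let $n\ge 1$ and $m\le n$ be positive integers, and let $p(z_1,z_2,\ldots,z_n)$ be a symmetric polynomial with complex coefficients in $n$ variables, of total degree $m$, and of degree $1$ in each variable $z_i$. Let $w_1,w_2,\ldots,w_n$ be complex numbers and put $q(z)=\prod_{i=1}^{n}(z-w_i)$. Suppose that $S\subseteq\mathbb{C}$ is a circular region that contains all zeros of the derivative $q^{(n-m)}(z)$ of order $n-m$ of $q$. Then the equation $$p(w_1,w_2,\ldots,w_n)=p(z,z,\ldots,z)$$ has a solution $z\in S$.
   Context: A circular region is a subset of $\mathbb{C}$ that is an open or closed disk, an open or closed half-plane, or the exterior (complement in $\mathbb{C}$) of an open or closed disk or half-plane. By convention $q^{(0)}=q$. *)

(* Defs.v *)
From mathcomp Require Import all_boot all_order all_algebra.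
From mathcomp Require Import classical_sets reals.
From mathcomp Require Import complex.
From mathcomp Require Import mpoly.

Set Implicit Arguments.
Unset Strict Implicit.
Unset Printing Implicit Defensive.

Import Order.TTheory GRing.Theory Num.Theory.

Local Open Scope classical_set_scope.
Local Open Scope complex_scope.
Local Open Scope ring_scope.

Definition open_disk (R : realType) (c : R[i]) (r : R) : set R[i] :=
  [set z | `|z - c| < r%:C].

Definition closed_disk (R : realType) (c : R[i]) (r : R) : set R[i] :=
  [set z | `|z - c| <= r%:C].

(* As Re ((u - iv) (x + iy)) = u x + v y, every half-plane
   u x + v y > b with (u, v) <> 0 is obtained from some a <> 0. *)
Definition open_half_plane (R : realType) (a : R[i]) (b : R) : set R[i] :=
  [set z | b < complex.Re (a * z)].

Definition closed_half_plane (R : realType) (a : R[i]) (b : R) : set R[i] :=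
  [set z | b <= complex.Re (a * z)].

Inductive circular_region (R : realType) : set R[i] -> Prop :=
| CircOpenDisk (c : R[i]) (r : R) of 0 < r :
    circular_region (open_disk c r)
| CircClosedDisk (c : R[i]) (r : R) of 0 < r :
    circular_region (closed_disk c r)
| CircOpenHalfPlane (a : R[i]) (b : R) of a != 0 :
    circular_region (open_half_plane a b)
| CircClosedHalfPlane (a : R[i]) (b : R) of a != 0 :
    circular_region (closed_half_plane a b)
| CircExtOpenDisk (c : R[i]) (r : R) of 0 < r :
    circular_region (~` open_disk c r)
| CircExtClosedDisk (c : R[i]) (r : R) of 0 < r :
    circular_region (~` closed_disk c r)
| CircExtOpenHalfPlane (a : R[i]) (b : R) of a != 0 :
    circular_region (~` open_half_plane a b)
| CircExtClosedHalfPlane (a : R[i]) (b : R) of a != 0 :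
    circular_region (~` closed_half_plane a b).

(* True degree (not shifted by one), with value 0 at p = 0. *)
Definition degree_in (n : nat) (A : nzRingType) (i : 'I_n) (p : {mpoly A[n]})
    : nat :=
  (\max_(k <- msupp p) k i)%N.

(* Main.v *)
Require Import Defs.
From mathcomp Require Import all_boot all_order all_algebra.
From mathcomp Require Import classical_sets reals.
From mathcomp Require Import complex.
From mathcomp Require Import perm mpoly.
From mathcomp Require Import ring lra zify.

Set Implicit Arguments.
Unset Strict Implicit.
Unset Printing Implicit Defensive.

Import Order.TTheory GRing.Theory Num.Theory.

Local Open Scope ring_scope.

(* A symmetric multiaffine polynomial is [\sum_k c_k e_k], with [e_k] the
   elementary symmetric polynomials. Up to a factor depending only on [k, m, n],
   [e_k(w_1, ..., w_n)] equals [e_k(u_1, ..., u_m)], where [u_1, ..., u_m] are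
   the zeros of [q^(n-m)]; so the claim reduces to Walsh's coincidence theorem in
   [m] variables for a form of exact degree [m] evaluated at points of [S].

   That case is Grace's theorem: if the polar form of [f] vanishes at points of
   [S], then [f] has a zero in [S]. Polarizing at one point [u] after another,
   it follows from Laguerre's theorem: a zero [z] in [S] of the polar derivative
   [N f + (u - X) f'] makes [1 / (z - u)] the average of the [1 / (z - r)] over
   the [N] zeros [r] of [f] (infinity included), while [r |-> 1 / (z - r)] maps
   the complement of [S] onto a convex set. *)

(** * Circular regions, averages and inversion *)

(* Every circular region is a set [circ_form > 0] or [circ_form >= 0], the
   flag [b] below telling whether the boundary is included; the point at
   infinity then belongs to the region when [0 < A ?<= if b]. *)
Definition circ_form (R : rcfType) (A : R) (B : R[i]) (C : R) (w : R[i]) : R :=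
  A * (complex.Re w ^+ 2 + complex.Im w ^+ 2) + complex.Re (B * w) + C.

Definition circ_set (R : rcfType) (A : R) (B : R[i]) (C : R) (b : bool) :
    pred R[i] :=
  [pred w | 0 < circ_form A B C w ?<= if b].

Lemma circ_form0 (R : rcfType) (A : R) (B : R[i]) (C : R) :
  circ_form A B C 0 = C.
Proof. by rewrite /circ_form; case: B => [x y] /=; ring. Qed.

Lemma open_diskE (R : realType) (c : R[i]) (r : R) w : 0 < r ->
  open_disk c r w <->
  circ_set (-1) (complex.Re c *+ 2 -i* (complex.Im c *+ 2))%C
    (r ^+ 2 - complex.Re c ^+ 2 - complex.Im c ^+ 2)
    false w.
Proof.
move=> r_gt0; rewrite /open_disk /= normc_def ltcR.
rewrite -{1}(gtr0_norm r_gt0) -sqrtr_sqr ltr_sqrt ?exprn_gt0 //.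
rewrite /circ_set inE lteifF /circ_form; case: w c => [x y] [c d] /=.
by rewrite !mulr2n; split => h; lra.
Qed.

Lemma closed_diskE (R : realType) (c : R[i]) (r : R) w : 0 < r ->
  closed_disk c r w <->
  circ_set (-1) (complex.Re c *+ 2 -i* (complex.Im c *+ 2))%C
    (r ^+ 2 - complex.Re c ^+ 2 - complex.Im c ^+ 2)
    true w.
Proof.
move=> r_gt0; rewrite /closed_disk /= normc_def lecR.
rewrite -{1}(gtr0_norm r_gt0) -sqrtr_sqr ler_sqrt ?sqr_ge0 //.
rewrite /circ_set inE lteifT /circ_form; case: w c => [x y] [c d] /=.
by rewrite !mulr2n; split => h; lra.
Qed.

Lemma open_half_planeE (R : realType) (a : R[i]) (b : R) w :
  open_half_plane a b w <-> circ_set 0 a (- b) false w.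
Proof.
by rewrite /circ_set inE lteifF /circ_form mul0r add0r subr_gt0.
Qed.

Lemma closed_half_planeE (R : realType) (a : R[i]) (b : R) w :
  closed_half_plane a b w <-> circ_set 0 a (- b) true w.
Proof.
by rewrite /circ_set inE lteifT /circ_form mul0r add0r subr_ge0.
Qed.

Lemma circ_setC (R : rcfType) (A : R) (B : R[i]) (C : R) b w :
  circ_set (- A) (- B) (- C) (~~ b) w = ~~ circ_set A B C b w.
Proof.
rewrite /circ_set !inE -lteifNE -lteif0Nr; congr (Order.lteif _ _ _).
by rewrite /circ_form; case: B w => [s t] [x y] /=; ring.
Qed.

Lemma circular_regionE {R : realType} {S : set R[i]} : circular_region S ->
  exists A B C b, forall w, S w <-> circ_set A B C b w.
Proof.
have compl (T : set R[i]) A B C b : (forall w, T w <-> circ_set A B C b w) ->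
    exists A B C b, forall w, (~` T)%classic w <-> circ_set A B C b w.
  move=> TE; exists (- A), (- B), (- C), (~~ b) => w.
  by rewrite circ_setC /setC /=; split => [nT|/negP nT /TE //];
    apply/negP => /TE.
case=> [c r|c r|a b|a b|c r|c r|a b|a b] h.
- by do 4!eexists; move=> w; apply: open_diskE.
- by do 4!eexists; move=> w; apply: closed_diskE.
- by do 4!eexists; move=> w; apply: open_half_planeE.
- by do 4!eexists; move=> w; apply: closed_half_planeE.
- by apply: compl => w; apply: open_diskE.
- by apply: compl => w; apply: closed_diskE.
- by apply: compl => w; apply: open_half_planeE.
- by apply: compl => w; apply: closed_half_planeE.
Qed.

(** Expansion of each term at [v]: the linear part vanishes when [v] is the average of [s], and the
    sum of squares carries the sign of [A]. *)
Lemma circ_form_sum (R : rcfType) (A : R) (B : R[i]) (C : R) (v : R[i])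
    (s : seq R[i]) :
  \sum_(w <- s) circ_form A B C w =
    (size s)%:R * circ_form A B C v
    + complex.Re (((A *+ 2)%:C * v^* + B) *
        (\sum_(w <- s) w - (size s)%:R * v))%C
    + A * \sum_(w <- s) (complex.Re (w - v) ^+ 2 + complex.Im (w - v) ^+ 2).
Proof.
elim: s => [|w s IHs]; first by rewrite !big_nil /= !mul0r subr0 mulr0 /=; ring.
have sizeE (K : nzRingType) : (size (w :: s))%:R = (size s)%:R + 1 :> K.
  by rewrite natr1.
rewrite !big_cons IHs {IHs} (sizeE R) (sizeE R[i]) {sizeE}.
set T := \sum_(w <- s) w; set U := \sum_(w <- s) (_ + _).
have -> : (size s)%:R = ((size s)%:R : R)%:C%C :> R[i] by rewrite rmorph_nat.
rewrite /circ_form; case: w v B T @U => [x y] [v1 v2] [b1 b2] [s1 s2] U /=.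
ring.
Qed.

(* With [A >= 0] the complement of the region is convex. *)
Lemma circ_set_average (R : rcfType) (A : R) (B : R[i]) (C : R) b (v : R[i])
    (s : seq R[i]) :
  0 <= A -> (0 < size s)%N -> \sum_(w <- s) w = (size s)%:R * v ->
  circ_set A B C b v -> has (circ_set A B C b) s.
Proof.
move=> A_ge0 s_gt0 sumE vS; apply/negPn/negP => /hasPn outS.
have := circ_form_sum A B C v s; rewrite sumE subrr mulr0 addr0.
set T := \sum_(w <- s) (_ ^+ 2 + _) => sumQ.
have T_ge0 : 0 <= T.
  by apply: sumr_ge0 => w _; rewrite addr_ge0 ?sqr_ge0.
have sN : 0 < (size s)%:R :> R by rewrite ltr0n.
have AT := mulr_ge0 A_ge0 T_ge0.
have {}outS w : w \in s -> circ_form A B C w < 0 ?<= if ~~ b.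
  by move=> ws; rewrite lteifNE; apply: outS.
(* Strictness comes from the points of [s] if the boundary is in the region, and from [v]
   otherwise. *)
case: b vS outS => /= vS outS.
  have : \sum_(w <- s) circ_form A B C w < 0.
    case: (s) s_gt0 outS => // a t _ outS; rewrite big_cons big_seq.
    rewrite ltr_wnDr ?outS ?mem_head // sumr_le0 // => w wt.
    by apply/ltW/outS; rewrite inE wt orbT.
  by rewrite sumQ ltNge => /negP; apply; rewrite addr_ge0 // mulr_ge0.
have : \sum_(w <- s) circ_form A B C w <= 0.
  by rewrite big_seq sumr_le0.
by rewrite sumQ leNgt => /negP; apply; rewrite ltr_wpDr // mulr_gt0.
Qed.

(* The left-hand side describes the image of the region under
   [r |-> 1 / (z - r)]: multiply the form at [r = z - 1 / y] by [|y|^2]. *)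
Lemma circ_set_inv (R : rcfType) (A : R) (B : R[i]) (C : R) b (z r : R[i]) :
  z != r ->
  circ_set (circ_form A B C z) (- ((A *+ 2)%:C * z + B^*))%C A b (z - r)^-1 =
  circ_set A B C b r.
Proof.
rewrite -subr_eq0 => y_neq0.
have N_gt0 : 0 < complex.Re (z - r) ^+ 2 + complex.Im (z - r) ^+ 2.
  move: y_neq0; rewrite eq_complex negb_and /= => /orP h.
  rewrite lt0r addr_ge0 ?sqr_ge0 // andbT paddr_eq0 ?sqr_ge0 // !sqrf_eq0.
  by rewrite negb_and; apply/orP.
rewrite /circ_set !inE -(lteif_pM2l _ N_gt0) mulr0; congr (Order.lteif _ _ _).
move: y_neq0 N_gt0 => _; rewrite /circ_form.
case: B z r => [s t] [x y] [c d] /=; set N := _ + _ => N_gt0.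
have N_neq0 : N != 0 by rewrite gt_eqF.
by rewrite /N in N_neq0 *; field.
Qed.

(** * Polarization of polynomials *)

Definition binomial_poly (K : nzRingType) (c : nat -> K) (m : nat) : {poly K} :=
  \poly_(k < m.+1) (c k *+ 'C(m, k)).

(** The polar derivative with pole [u], divided by the formal degree: with binomial weights it acts
    on coefficients by one formula in all degrees. *)
Definition polarize (K : nzRingType) (u : K) (c : nat -> K) : nat -> K :=
  fun k => c k + u * c k.+1.

(* For [m = size us] this is the value at [us] of the symmetric multiaffine
   form in [m] variables that restricts to [binomial_poly c m] on the
   diagonal. *)
Fixpoint polar_form (K : nzRingType) (c : nat -> K) (us : seq K) : K :=
  if us is u :: us' then polar_form (polarize u c) us' else c 0%N.

Lemma coef_binomial_poly (K : nzRingType) (c : nat -> K) m k :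
  (binomial_poly c m)`_k = c k *+ 'C(m, k).
Proof.
by rewrite coef_poly; case: ltnP => // mk; rewrite bin_small ?mulr0n.
Qed.

(** Terms in [c k.+1] match by (k+1) C(m+1,k+1) = (m+1) C(m,k), terms in [c k] by (m+1-k) C(m+1,k) =
    (m+1) C(m,k). *)
Lemma binomial_poly_polarize (K : comNzRingType) (u : K) (c : nat -> K) m :
  binomial_poly (polarize u c) m *+ m.+1 =
  binomial_poly c m.+1 *+ m.+1 + (u%:P - 'X) * (binomial_poly c m.+1)^`().
Proof.
apply/polyP => k; rewrite coefD coefMn mulrBl coefB coefCM coefMn coefXM.
rewrite !coef_deriv !coef_binomial_poly /polarize -!mulrnA.
have -> : ('C(m, k) * m.+1 = 'C(m.+1, k.+1) * k.+1)%N.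
  by rewrite mulnC (mulnC _ k.+1) -mul_bin_diag.
case: k => [|k] /=.
  by rewrite subr0 !bin0 bin1 mulrnDl mulrnAr !mul1n muln1.
rewrite mulrnDl mulrnAr addrCA [LHS]addrC; congr (_ + _).
have [km|km] := leqP k.+1 m.+1; last first.
  by rewrite !bin_small ?mul0n ?mulr0n ?subr0 // ltnS ltnW.
rewrite -mulrnBr; last by rewrite leq_mul2l km orbT.
congr (_ *+ _); rewrite -mulnBr mulnC -mul_bin_diag /= mul_bin_down.
by rewrite mulnC.
Qed.

(** By Vieta's formulas the factor of [c k] is e_k(us); the induction step is e_k(u, us) = e_k(us) +
    u e_{k-1}(us). *)
Lemma polar_formE (K : comNzRingType) (us : seq K) (c : nat -> K) :
  polar_form c us = \sum_(k < (size us).+1)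
    c k * ((-1) ^+ k * (\prod_(u <- us) ('X - u%:P))`_(size us - k)).
Proof.
elim: us c => [|u us IHus] c /=.
  by rewrite big_ord_recl big_ord0 big_nil coef1 addr0 !mulr1.
rewrite IHus big_cons; set G := \prod_(j <- us) _; set N := size us.
have GN : G`_N.+1 = 0 by rewrite nth_default // size_prod_XsubC.
under [RHS]eq_bigr => k _.
  rewrite mulrBl coefB coefXM coefCM mulrBr mulrBr; over.
rewrite sumrB [X in _ = X - _]big_ord_recr /= subnn !mulr0 addr0.
rewrite [X in _ = _ - X]big_ord_recl /= subn0 GN !mulr0 add0r -sumrN.
rewrite -big_split /=.
apply: eq_bigr => k _; rewrite /polarize mulrDl; congr (_ + _).
  have kN : (k <= N)%N by rewrite -ltnS.
  by rewrite subSn //=.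
by rewrite /bump /= add1n subSS exprS; ring.
Qed.

(** * Laguerre's and Grace's theorems *)

Lemma horner_deriv_prod_XsubC (K : fieldType) (rs : seq K) (z : K) :
  z \notin rs ->
  (\prod_(r <- rs) ('X - r%:P))^`().[z] =
  (\prod_(r <- rs) ('X - r%:P)).[z] * \sum_(r <- rs) (z - r)^-1.
Proof.
elim: rs => [|r rs IHrs]; first by rewrite !big_nil derivE horner0 mulr0.
rewrite inE negb_or => /andP[zr /IHrs E]; rewrite !big_cons derivM.
rewrite hornerD !hornerM E derivXsubC hornerC hornerXsubC.
by field; rewrite subr_eq0.
Qed.

(* A polynomial of degree less than [N] counts as having a zero at infinity. *)
Lemma laguerre (R : rcfType) (A : R) (B : R[i]) (C : R) (b : bool)
    (N : nat) (f : {poly R[i]}) (u z : R[i]) :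
  (0 < N)%N -> f != 0 -> (size f <= N.+1)%N ->
  (0 < A ?<= if b -> size f = N.+1) ->
  u \in circ_set A B C b -> z \in circ_set A B C b ->
  root (f *+ N + (u%:P - 'X) * f^`()) z ->
  exists2 r, r \in circ_set A B C b & root f r.
Proof.
set S := circ_set A B C b.
move=> N_gt0 f_neq0 f_size f_inf uS zS fz0.
have [fz|fz_neq0] := boolP (root f z); first by exists z.
have [rs fE] := closed_field_poly_normal f.
have a_neq0 : lead_coef f != 0 by rewrite lead_coef_eq0.
have rootfE r : root f r = (r \in rs).
  by rewrite fE rootZ // root_prod_XsubC.
have sizef : size f = (size rs).+1 by rewrite fE size_scale // size_prod_XsubC.
have [/hasP[r r_rs rS]|/negP[]] := boolP (has S rs).
  by exists r; rewrite ?rootfE.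
have z_rs : z \notin rs by rewrite -rootfE.
have uz : z != u.
  apply: contraNneq fz_neq0 => zu; move: fz0.
  rewrite /root hornerD hornerM hornerD hornerN hornerC hornerX zu subrr mul0r.
  by rewrite addr0 hornerMn mulrn_eq0 gtn_eqF.
have sumE : \sum_(r <- rs) (z - r)^-1 = N%:R * (z - u)^-1.
  move: fz0; rewrite /root hornerD hornerM hornerD hornerN hornerC hornerX.
  rewrite fE derivZ !hornerMn !hornerZ horner_deriv_prod_XsubC //.
  rewrite (mulrA (lead_coef f)) -hornerZ -fE; set s := \sum_(r <- rs) _.
  move=> /eqP E.
  have /eqP : f.[z] * (N%:R - (z - u) * s) = 0.
    by rewrite -[RHS]E -mulr_natr; ring.
  rewrite mulf_eq0 -rootE (negPf fz_neq0) subr_eq0 => /eqP ->.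
  by rewrite mulrC mulKf ?subr_eq0.
(* The padding by zeros stands for the zeros of [f] at infinity. *)
pose ys := [seq (z - r)^-1 | r <- rs] ++ nseq (N - size rs) 0.
have ys_size : size ys = N.
  by rewrite size_cat size_map size_nseq subnKC // -ltnS -sizef.
(* As [z] is in the region, the image form has nonnegative leading coefficient, so averaging
   applies; the average is the image of [u]. *)
have : has (circ_set (circ_form A B C z) (- ((A *+ 2)%:C * z + B^*))%C A b) ys.
  apply: (@circ_set_average _ _ _ _ _ (z - u)^-1); rewrite ?ys_size //.
  - exact: lteifW zS.
  - by rewrite big_cat big_map big_nseq /= iter_addr_0 mul0rn addr0.
  - by rewrite circ_set_inv.
rewrite has_cat has_map has_nseq => /orP[/hasP[r r_rs rS]|/andP[rsN]].
  apply/hasP; exists r => //; move: rS; rewrite /= circ_set_inv //.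
  by apply: contraNneq z_rs => ->.
(* A padding zero in the image puts infinity in the region; then [f] has full degree and there is no
   padding. *)
rewrite /circ_set inE circ_form0 => /f_inf.
by rewrite sizef => -[rsE]; rewrite rsE subnn in rsN.
Qed.

(** When infinity belongs to the region, the condition on [c (size us)] forces exact degree, so that
    the zero found is finite. *)
Lemma grace (R : rcfType) (A : R) (B : R[i]) (C : R) (b : bool)
    (us : seq R[i]) (c : nat -> R[i]) :
  all (circ_set A B C b) us -> polar_form c us = 0 ->
  binomial_poly c (size us) != 0 ->
  (0 < A ?<= if b -> c (size us) != 0) ->
  exists2 z, z \in circ_set A B C b & root (binomial_poly c (size us)) z.
Proof.
set S := circ_set A B C b.
elim: us c => [|u us IHus] c /=.
  move=> _ c0 /negP[]; apply/eqP/polyP => k.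
  rewrite coef_binomial_poly coef0; case: k => [|k]; first by rewrite c0.
  by rewrite bin_small ?mulr0n.
move=> /andP[uS usS] c_us f_neq0 f_inf.
set f := binomial_poly c _ in f_neq0 *; set c' := polarize u c in c_us.
have f'E := binomial_poly_polarize u c (size us).
have [f'0|f'_neq0] := eqVneq (binomial_poly c' (size us)) 0.
  (* At [u] the polar derivative is a nonzero multiple of [f.[u]]. *)
  exists u => //; move/(congr1 (horner^~ u)): f'E.
  rewrite f'0 mul0rn horner0 hornerD hornerM !hornerE subrr mul0r addr0.
  by move=> /esym/eqP; rewrite hornerMn mulrn_eq0.
have f_size : (size f <= (size us).+2)%N by apply: size_poly.
have f_top : f`_(size us).+1 = c (size us).+1.
  by rewrite coef_binomial_poly binn.
have sizefE : 0 < A ?<= if b -> size f = (size us).+2.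
  move=> /f_inf c_neq0; apply/eqP; rewrite eqn_leq f_size ltnNge.
  by apply: contraNN c_neq0 => f_small; rewrite -f_top nth_default.
have [/andP[A_inf /eqP c'0]|no_drop] :=
    boolP ((0 < A ?<= if b) && (c' (size us) == 0)); last first.
  have [|z zS f'z] := IHus c' usS c_us f'_neq0.
    by move=> A_inf; move: no_drop; rewrite A_inf.
  apply: (@laguerre _ A B C b (size us).+1 f u z) => //.
  by rewrite -f'E rootE hornerMn mulrn_eq0.
(* The polar loses degree exactly when [u] is the centroid of the roots. *)
have [rs fE] := closed_field_poly_normal f.
have c_neq0 := f_inf A_inf.
have a_E : lead_coef f = c (size us).+1 by rewrite lead_coefE sizefE.
have a_neq0 : lead_coef f != 0 by rewrite a_E.
have rs_size : size rs = (size us).+1.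
  by apply: succn_inj; rewrite -sizefE // fE size_scale // size_prod_XsubC.
have sumE : \sum_(r <- rs) r = (size rs)%:R * u.
  apply: (mulfI c_neq0); apply: oppr_inj.
  have := coef_binomial_poly c (size us).+1 (size us).
  rewrite -/f [in LHS]fE coefZ a_E binSn.
  have -> : (\prod_(r <- rs) ('X - r%:P))`_(size us) = - \sum_(r <- rs) r.
    by rewrite -coefPn_prod_XsubC ?rs_size.
  move: c'0; rewrite /c' /polarize mulrN => /eqP.
  rewrite addr_eq0 => /eqP -> ->.
  by rewrite rs_size -mulr_natr; ring.
(* [A_inf] gives [0 <= A], so the complement is convex: it cannot contain all roots while their
   centroid [u] is in the region. *)
have /hasP[r r_rs rS] : has S rs.
  apply: (@circ_set_average _ _ _ _ _ u) => //; first exact: lteifW A_inf.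
  by rewrite rs_size.
by exists r => //; rewrite fE rootZ // root_prod_XsubC.
Qed.

(** * Symmetric multiaffine polynomials *)

(** Used to see that length and sum determine a 0/1 sequence up to permutation; the zeros are
    counted without truncated subtraction. *)
Lemma count_bits (a : pred nat) (s : seq nat) : all (fun x => x <= 1)%N s ->
  (count a s + a 0 * sumn s = a 1 * sumn s + a 0 * size s)%N.
Proof.
elim: s => [|x s IHs] /=; first by rewrite !muln0.
by case: x => [|[|x]] //= /IHs IH; case: (a 0) (a 1) IH => [] [] /=; lia.
Qed.

Lemma symmetric_mechar_coeff (K : nzRingType) n (p : {mpoly K[n]}) k
    (m1 m2 : 'X_{1..n}) :
  p \is symmetric -> mechar k m1 -> mechar k m2 -> p@_m1 = p@_m2.
Proof.
move=> p_sym /andP[/eqP deg1 /forallP le1] /andP[/eqP deg2 /forallP le2].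
have bits (m : 'X_{1..n}) : (forall i, m i <= 1)%N -> all (fun x => x <= 1)%N m.
  by move=> le_m; apply/all_tnthP.
have sumnE (m : 'X_{1..n}) : sumn m = mdeg m by rewrite mdegE sumnE big_tuple.
have /tuple_permP[s m1E] : perm_eq m1 m2.
  apply/seq.permP => a; apply/eqP; rewrite -(eqn_add2r (a 0 * k)%N); apply/eqP.
  rewrite -[in LHS]deg1 -[in RHS]deg2 -!sumnE !count_bits ?bits //.
  by rewrite !size_tuple !sumnE deg1 deg2.
rewrite -(msym_coeff m2 s p_sym); congr (_@__).
apply/mnmP => i; rewrite mnmE /fun_of_multinom.
by rewrite (tnth_nth 0%N) m1E nth_mktuple.
Qed.

Lemma mechar_mlead_mesym (K : nzRingType) n k :
  (k <= n)%N -> mechar k (mlead (mesym n K k)).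
Proof. by move=> kn; rewrite -(mem_msupp_mesym K) mlead_supp // mesym_neq0. Qed.

(** Only monomials with 0/1 exponents occur, and by symmetry their coefficient depends on the degree
    alone; [mlead (mesym n K k)] represents degree [k]. *)
Lemma symmetric_multiaffineE (K : nzRingType) n (p : {mpoly K[n]}) :
  p \is symmetric -> (forall i, degree_in i p <= 1)%N ->
  p = \sum_(k < n.+1) p@_(mlead (mesym n K k)) *: mesym n K k.
Proof.
move=> p_sym p_deg1; apply/mpolyP => m; rewrite raddf_sum /=.
under eq_bigr do rewrite mcoeffZ mcoeff_mesym.
have [/forallP le_m|not_bits] := boolP [forall i, m i <= 1]%N; last first.
  rewrite big1 => [|k _]; last by rewrite /mechar (negPf not_bits) andbF mulr0.
  apply: memN_msupp_eq0; apply: contra not_bits => pm; apply/forallP => i.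
  apply: leq_trans (p_deg1 i).
  by apply: (@leq_bigmax_seq _ _ xpredT (fun k : 'X_{1..n} => k i)).
have deg_m : (mdeg m < n.+1)%N.
  rewrite ltnS mdegE -[leqRHS]card_ord -sum1_card.
  by apply: leq_sum => i _.
have m_char : mechar (mdeg m) m by rewrite /mechar eqxx; apply/forallP.
rewrite (bigD1 (Ordinal deg_m)) //= m_char mulr1 big1 ?addr0 => [|k].
  by apply: symmetric_mechar_coeff m_char (mechar_mlead_mesym _ _).
by rewrite -val_eqE /mechar eq_sym => /negPf /= ->; rewrite mulr0.
Qed.

(** Multiplied by k! (m-k)!, both sides become n!. Hence the ratio of falling factorials relating
    e_k(w) to e_k(us) is also C(n,k) / C(m,k). *)
Lemma bin_mul_ffact n m k : (k <= m <= n)%N ->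
  ('C(m, k) * n ^_ (n - m) = 'C(n, k) * (n - k) ^_ (n - m))%N.
Proof.
move=> /andP[km mn]; have kn := leq_trans km mn.
apply/eqP; rewrite -(eqn_pmul2r (fact_gt0 k)) -(eqn_pmul2r (fact_gt0 (m - k))).
have mk : (m - k = n - k - (n - m))%N by lia.
have := ffact_fact (leq_subr m n); rewrite subKn // => nE.
have lE : ('C(m, k) * n ^_ (n - m) * k`! * (m - k)`! = n`!)%N.
  by rewrite -nE -(bin_fact km); ring.
rewrite lE [in X in _ == (_ * X)%N]mk -(bin_fact kn).
by rewrite -(@ffact_fact (n - k) (n - m)) ?leq_sub2l //; apply/eqP; ring.
Qed.

Lemma meval_mesym_const (K : comNzRingType) n k (z : K) :
  (mesym n K k).@[fun=> z] = z ^+ k *+ 'C(n, k).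
Proof.
rewrite /mesym rmorph_sum /=.
under eq_bigr => h /eqP hk.
  rewrite rmorph_prod /=; under eq_bigr do rewrite mevalXU.
  rewrite prodr_const hk; over.
by rewrite sumr_const -cardsE card_draws card_ord.
Qed.

Lemma meval_mesym_coef (K : idomainType) n (w : 'I_n -> K) (k : 'I_n.+1) :
  (mesym n K k).@[w] = (-1) ^+ k * (\prod_(i < n) ('X - (w i)%:P))`_(n - k).
Proof.
have := mroots_coeff [tuple w i | i < n] k.
rewrite big_tuple; under eq_bigr do rewrite tnth_mktuple.
move=> ->; rewrite mulrA -exprMn mulrNN mulr1 expr1n mul1r.
rewrite !mevalE; apply: eq_bigr => h _; congr (_ * _).
by apply: eq_bigr => i _; rewrite tnth_mktuple.
Qed.

(** * Reduction to Grace's theorem *)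

Theorem theorem1 (R : realType) (n m : nat)
    (hn : (1 <= n)%N) (hm : (1 <= m)%N) (hmn : (m <= n)%N)
    (p : {mpoly R[i][n]})
    (p_sym : p \is symmetric)
    (p_deg : msize p = m.+1)
    (p_deg1 : forall i : 'I_n, degree_in i p = 1%N)
    (w : 'I_n -> R[i])
    (q : {poly R[i]})
    (hq : q = \prod_(i < n) ('X - (w i)%:P))
    (S : set R[i])
    (S_circ : circular_region S)
    (S_zeros : forall z : R[i], root q^`(n - m) z -> S z) :
  exists2 z : R[i], S z & p.@[w] = p.@[fun=> z].
Proof.
pose c k := p@_(mlead (mesym n R[i] k)).
have pE : p = \sum_(k < n.+1) c k *: mesym n R[i] k.
  by apply: symmetric_multiaffineE => // i; rewrite p_deg1.
have p_neq0 : p != 0 by rewrite -msize_poly_eq0 p_deg.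
have c_gt k : (m < k <= n)%N -> c k = 0.
  move=> /andP[mk kn]; apply: memN_msupp_eq0; apply/negP => /msize_mdeg_lt.
  have /andP[/eqP -> _] := mechar_mlead_mesym R[i] kn.
  by rewrite p_deg ltnS leqNgt mk.
have c_m : c m != 0.
  have deg_p : mdeg (mlead p) = m by apply: succn_inj; rewrite mlead_deg.
  have supp_p := mlead_supp p_neq0.
  rewrite /c (@symmetric_mechar_coeff _ _ _ m _ (mlead p)) -?mcoeff_msupp //.
    exact: mechar_mlead_mesym.
  rewrite /mechar deg_p eqxx; apply/forallP => i; rewrite -(p_deg1 i).
  exact: (@leq_bigmax_seq _ _ xpredT (fun k : 'X_{1..n} => k i)).
have mevalpE (v : 'I_n -> R[i]) :
    p.@[v] = \sum_(k < m.+1) c k * (mesym n R[i] k).@[v].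
  rewrite {1}pE rmorph_sum /=; under eq_bigr do rewrite mevalZ.
  rewrite [RHS](big_ord_widen n.+1 (fun k => c k * (mesym n R[i] k).@[v])) //.
  rewrite [RHS]big_mkcond /=; apply: eq_bigr => k _; case: ifPn => // km.
  by rewrite c_gt ?mul0r //; move: (ltn_ord k) km; lia.
have q_size : size q = n.+1.
  by rewrite hq size_prod_XsubC /= /index_enum -enumT size_enum_ord.
have q_lead : q`_n = 1.
  have := lead_coef_prod_XsubC (index_enum 'I_n) xpredT w.
  by rewrite -hq lead_coefE q_size.
set qd := q^`(n - m) in S_zeros.
have qdE k : (k <= m)%N -> qd`_(m - k) = q`_(n - k) *+ (n - k) ^_ (n - m).
  by move=> km; rewrite coef_derivn addnBA // subnK.
have ffact_neq0 k : (k <= m)%N -> ((n - k) ^_ (n - m))%:R != 0 :> R[i].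
  by move=> km; rewrite pnatr_eq0 -lt0n ffact_gt0 leq_sub2l.
have qd_lead : qd`_m = (n ^_ (n - m))%:R.
  by have := qdE 0%N isT; rewrite !subn0 q_lead.
have L_neq0 : (n ^_ (n - m))%:R != 0 :> R[i].
  by have := ffact_neq0 0%N isT; rewrite subn0.
have qd_size : size qd = m.+1.
  apply/eqP; rewrite eqn_leq; apply/andP; split.
    apply/leq_sizeP => j mj; rewrite coef_derivn nth_default ?mul0rn // q_size.
    lia.
  rewrite ltnNge; apply: contraNN L_neq0 => /leq_sizeP/(_ m (leqnn m)) <-.
  by rewrite qd_lead.
have [us qd_us] := closed_field_poly_normal qd.
rewrite lead_coefE qd_size /= qd_lead in qd_us.
have us_size : size us = m.
  by apply: succn_inj; rewrite -qd_size qd_us size_scale // size_prod_XsubC.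
(* The quotient turns e_k(us) into e_k(w) in the polar form and C(m,k) into C(n,k) on the diagonal.
   Subtracting [p.@[w]] from the constant term makes the polar form vanish at [us]. *)
pose c' k := c k * (n ^_ (n - m))%:R / ((n - k) ^_ (n - m))%:R
             - (k == 0%N)%:R * p.@[w].
have c'_coef (k : nat) : (k <= m)%N -> c' k *+ 'C(m, k) =
    c k *+ 'C(n, k) - (k == 0%N)%:R * p.@[w].
  move=> km; rewrite /c' mulrnBl; congr (_ - _); last first.
    by case: k km => [|k] _; rewrite ?bin0 ?mul0r ?mul0rn.
  rewrite -[LHS]mulr_natr -[RHS]mulr_natr; apply: (mulIf (ffact_neq0 k km)).
  rewrite mulrAC mulfVK ?ffact_neq0 // -!mulrA -!natrM -bin_mul_ffact ?km //.
  by rewrite mulnC.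
have U_coef k : (k <= m)%N ->
    (n ^_ (n - m))%:R * (\prod_(u <- us) ('X - u%:P))`_(m - k)
    = q`_(n - k) * ((n - k) ^_ (n - m))%:R.
  by move=> km; rewrite -coefZ -qd_us qdE // mulr_natr.
have c'_polar : polar_form c' us = 0.
  rewrite polar_formE us_size.
  transitivity (\sum_(k < m.+1) (c k * (mesym n R[i] k).@[w]
                  - (if k == 0%N :> nat then p.@[w] else 0))).
    apply: eq_bigr => k _; have km : (k <= m)%N by rewrite -ltnS.
    rewrite /c' mulrBl; congr (_ - _).
      have kn : (k < n.+1)%N by rewrite ltnS (leq_trans km).
      rewrite (meval_mesym_coef w (Ordinal kn)) -hq /=.
      apply: (mulIf (ffact_neq0 k km)); rewrite mulrAC mulfVK ?ffact_neq0 //.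
      by rewrite -mulrA (mulrCA _ ((-1) ^+ k)) U_coef //; ring.
    have [->|_] := eqVneq (k : nat) 0%N; last by rewrite !mul0r.
    have := U_coef 0%N isT; rewrite !subn0 q_lead mulrC => /(mulIf L_neq0) ->.
    by rewrite expr0 !mulr1 mul1r.
  by rewrite sumrB -mevalpE big_ord_recl /= big1 ?addr0 ?subrr.
(* As [m >= 1], the constant correction misses the top coefficient. *)
have c'_m : c' m != 0.
  rewrite /c' (gtn_eqF hm) mul0r subr0 mulf_neq0 ?invr_eq0 ?ffact_neq0 //.
  by rewrite mulf_neq0.
have f_eval z : (binomial_poly c' m).[z] = p.@[fun=> z] - p.@[w].
  rewrite horner_poly [p.@[fun=> z]]mevalpE.
  transitivity (\sum_(k < m.+1) (c k * (mesym n R[i] k).@[fun=> z]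
                  - (if k == 0%N :> nat then p.@[w] else 0))).
    apply: eq_bigr => k _; have km : (k <= m)%N by rewrite -ltnS.
    rewrite (c'_coef _ km) mulrBl meval_mesym_const; congr (_ - _).
      by rewrite mulrnAl mulrnAr.
    have [->|_] := eqVneq (k : nat) 0%N; last by rewrite !mul0r.
    by rewrite expr0 mulr1 mul1r.
  by rewrite sumrB; congr (_ - _); rewrite big_ord_recl /= big1 ?addr0.
have [A [B [C [b SE]]]] := circular_regionE S_circ.
have us_S : all (circ_set A B C b) us.
  apply/allP => u u_us; apply/SE/S_zeros.
  by rewrite qd_us rootZ // root_prod_XsubC.
have [||z zS] := grace us_S c'_polar; rewrite us_size //.
  apply: contraNneq c'_m => f0; have := coef_binomial_poly c' m m.
  by rewrite f0 coef0 binn mulr1n => <-.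
rewrite rootE f_eval subr_eq0 => /eqP fz.
by exists z => //; apply/SE.
Qed.
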